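(* Assume that $r:\mathbb{R}^n\to\mathbb{R}$ is Lipschitz continuous and upper-$C^2$. Then Algorithm A (see context) applied to problem (P) produces only a finite number of rejected steps. As a consequence, the quadratic coefficient $\alpha_k$ is bounded above and stays constant for $k$ large enough.
   Context: Problem (P): minimize $r(x)$ over $x\in\mathbb{R}^n$ subject to $c(x)=0$, $0\le x\le x_u$ (componentwise), with $x_u\in\mathbb{R}^n$ fixed and $c:\mathbb{R}^n\to\mathbb{R}^m$ continuously differentiable. $\nabla c(x)$ is the $n\times m$ matrix with columns $\nabla c_j(x)$. $\|\cdot\|$, $\|\cdot\|_1$, $\|\cdot\|_\infty$ are the 2-, 1- and infinity-norms. $\bar\partial r(x)$ is the Clarke subdifferential. Upper-$C^2$: each point has a neighborhood $V$ on which $r(x)=\min_{t\in T}p(t,x)$, with $T$ compact and $p$ together with its first- and second-order partial derivatives in $x$ continuous in $(t,x)\in T\times V$. In particular there is $\rho>0$ with $r(x)-r(\bar x)-\langle g,x-\bar x\rangle\le\frac{\rho}{2}\|x-\bar x\|^2$ for all $x,\bar x$ in the box $\{0\le x\le x_u\}$ and all $g\in\bar\partial r(\bar x)$. Algorithm A (simplified bundle method). Constants: $0<\eta_l^+\le1$, $\eta_l^-\ge1$, $0<\eta_\beta<\eta_\gamma^+\le1$, $\eta_\gamma^-\ge1$, $\eta_\alpha>1$, $\gamma>0$. Initial data: $x_0$ with $0\le x_0\le x_u$, $\alpha_0>0$, $\theta_{-1}>0$. For $k=0,1,2,\dots$: 1. Take $g_k\in\bar\partial r(x_k)$, $\Phi_k(d)=r(x_k)+g_k^Td+\frac12\alpha_k\|d\|^2$.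 Let $d_k$ solve the QP: minimize $\Phi_k(d)$ subject to $c(x_k)+\nabla c(x_k)^Td=0$, $-x_k\le d\le x_u-x_k$, with Lagrange multipliers $\lambda^{k+1}\in\mathbb{R}^m$, $\zeta_l^{k+1},\zeta_u^{k+1}\ge0$ in $\mathbb{R}^n$ satisfying $g_k+\alpha_kd_k-\nabla c(x_k)\lambda^{k+1}-\zeta_l^{k+1}+\zeta_u^{k+1}=0$, $(\zeta_l^{k+1})_i(x_k+d_k)_i=0$, $(\zeta_u^{k+1})_i(x_k+d_k-x_u)_i=0$ for all $i$. 2. Stop if $\|d_k\|\le\epsilon$ (tolerance). 3. $\delta_k=-g_k^Td_k-\frac12\alpha_k\|d_k\|^2$; $\rho_k=r(x_k)-r(x_k+d_k)-\eta_l^+\delta_k$ if $\delta_k\ge0$, and $\rho_k=r(x_k)-r(x_k+d_k)-\eta_l^-\delta_k$ if $\delta_k<0$. 4. $\theta_k=\max\{\theta_{k-1},\eta_\gamma^-\|\lambda^{k+1}\|_\infty+\gamma\}$. 5. If $\rho_k>0$: let $\beta_k$ be the first of $1,\frac12,\frac14,\dots$ such that $\theta_k\|c(x_k)\|_1-\eta_\gamma^-\beta_k|(\lambda^{k+1})^Tc(x_k)|\ge\theta_k\|c(x_k+\beta_kd_k)\|_1-\eta_\beta\frac12\alpha_k\beta_k\|d_k\|^2$. Let $\delta_k^\beta=-\beta_kg_k^Td_k-\frac12\beta_k^2\alpha_k\|d_k\|^2$ and $\rho_k^\beta=r(x_k)-r(x_k+\beta_kd_k)-\eta_\gamma^+\delta_k^\beta$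 if $\delta_k^\beta\ge0$, $\rho_k^\beta=r(x_k)-r(x_k+\beta_kd_k)-\eta_\gamma^-\delta_k^\beta$ if $\delta_k^\beta<0$. If $\rho_k^\beta\ge0$, take the serious step $x_{k+1}=x_k+\beta_kd_k$, $\alpha_{k+1}=\alpha_k$. 6. If $\rho_k\le0$, or $\rho_k>0$ and $\rho_k^\beta<0$, the step is rejected: $x_{k+1}=x_k$, $\alpha_{k+1}=\eta_\alpha\alpha_k$. Standing conventions: every QP in step 1 is feasible and every line search in step 5 terminates; $\epsilon=0$ and the algorithm does not stop, i.e. $\|d_k\|>0$ for all $k$. *)

(* Defs.v *)
From mathcomp Require Import all_boot all_order all_algebra.
From mathcomp Require Import all_classical all_reals all_analysis.
Set Implicit Arguments.
Unset Strict Implicit.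
Unset Printing Implicit Defensive.
Import Order.TTheory GRing.Theory Num.Theory.
Import numFieldNormedType.Exports.
Local Open Scope classical_set_scope.
Local Open Scope ring_scope.

(* R^n is the type 'rV[R]_n of row vectors.  The library norm `|v| on it is   *)
(* the infinity-norm; the topology is of course that of any norm.  With this  *)
(* convention jacobian c x : 'M[R]_(n, m) has (i, j) entry dc_j/dx_i, i.e. it *)
(* is the matrix with columns grad c_j (x), and (grad c)^T d is written       *)
(* d *m jacobian c x, while (grad c) lambda is written                        *)
(* lambda *m (jacobian c x)^T.                                                *)

Definition dot (R : realType) (n : nat) (u v : 'rV[R]_n) : R :=
  \sum_i u 0 i * v 0 i.

Definition norm1 (R : realType) (n : nat) (u : 'rV[R]_n) : R :=
  \sum_i `|u 0 i|.

Definition norm2 (R : realType) (n : nat) (u : 'rV[R]_n) : R :=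
  Num.sqrt (\sum_i u 0 i ^+ 2).

Definition lev (R : realType) (n : nat) (u v : 'rV[R]_n) : Prop :=
  forall i, u 0 i <= v 0 i.

Definition continuously_differentiable (R : realType) (n m : nat)
    (c : 'rV[R]_n -> 'rV[R]_m) : Prop :=
  (forall x, differentiable c x) /\ continuous (jacobian c).

(* Clarke's generalized directional derivative                                *)
(*   limsup_(y -> x, t -> 0+) (r (y + t v) - r y) / t                         *)
Definition clarke_dd (R : realType) (n : nat) (r : 'rV[R]_n -> R)
    (x v : 'rV[R]_n) : \bar R :=
  limf_esup (fun z : 'rV[R]_n * R => ((r (z.1 + z.2 *: v) - r z.1) / z.2)%:E)
            (filter_prod (nbhs x) (0^'+)).

Definition clarke_subdiff (R : realType) (n : nat) (r : 'rV[R]_n -> R)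
    (x : 'rV[R]_n) : set 'rV[R]_n :=
  [set g | forall v, ((dot g v)%:E <= clarke_dd r x v)%E].

Definition partial (R : realType) (n : nat) (i : 'I_n) (f : 'rV[R]_n -> R) :
    'rV[R]_n -> R :=
  fun x => 'D_(delta_mx 0 i) f x.

(* As V will be open, continuity on T x V is continuity at each of its points. *)
Definition jointly_continuous_on (R : realType) (n : nat)
    (T : topologicalType) (V : set 'rV[R]_n) (f : T -> 'rV[R]_n -> R) : Prop :=
  forall t x, V x ->
    {for (t, x), continuous (fun z : T * 'rV[R]_n => f z.1 z.2)}.

Definition jointly_C2_on (R : realType) (n : nat)
    (T : topologicalType) (V : set 'rV[R]_n) (p : T -> 'rV[R]_n -> R) : Prop :=
  [/\ jointly_continuous_on V p,
      forall i t x, V x -> derivable (p t) x (delta_mx 0 i),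
      forall i, jointly_continuous_on V (fun t => partial i (p t)),
      forall i j t x, V x -> derivable (partial i (p t)) x (delta_mx 0 j)
    & forall i j, jointly_continuous_on V (fun t => partial j (partial i (p t)))].

Definition upper_C2 (R : realType) (n : nat) (r : 'rV[R]_n -> R) : Prop :=
  forall x0, exists (V : set 'rV[R]_n) (T : topologicalType)
                    (p : T -> 'rV[R]_n -> R),
    [/\ open V, V x0, compact [set: T], jointly_C2_on V p
      & forall x, V x ->
          (exists t, r x = p t x) /\ (forall t, r x <= p t x)].

(* The suffixes p and m stand for the superscripts + and -.                   *)
Record constants (R : realType) := Constants {
  eta_lp : R; eta_lm : R;
  eta_beta : R;
  eta_gp : R; eta_gm : R;
  eta_alpha : R;
  gam : R }.

Definition admissible (R : realType) (C : constants R) : Prop :=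
  [/\ 0 < eta_lp C <= 1, 1 <= eta_lm C,
      [/\ 0 < eta_beta C, eta_beta C < eta_gp C & eta_gp C <= 1],
      1 <= eta_gm C & 1 < eta_alpha C /\ 0 < gam C].

(* ml k, zl k and zu k are the multipliers lambda^{k+1}, zeta_l^{k+1} and     *)
(* zeta_u^{k+1} of the k-th QP; theta_init is theta_{-1}; beta k is           *)
(* meaningful only when 0 < rho k.                                            *)
Record iterates (R : realType) (n m : nat) := Iterates {
  xs : nat -> 'rV[R]_n;
  alpha : nat -> R;
  g : nat -> 'rV[R]_n;
  d : nat -> 'rV[R]_n;
  ml : nat -> 'rV[R]_m;
  zl : nat -> 'rV[R]_n;
  zu : nat -> 'rV[R]_n;
  theta_init : R;
  theta : nat -> R;
  beta : nat -> R }.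

Definition qp_objective (R : realType) (n : nat) (r : 'rV[R]_n -> R)
    (x g : 'rV[R]_n) (a : R) (d : 'rV[R]_n) : R :=
  r x + dot g d + 2^-1 * a * norm2 d ^+ 2.

Definition qp_feasible (R : realType) (n m : nat) (c : 'rV[R]_n -> 'rV[R]_m)
    (xu x d : 'rV[R]_n) : Prop :=
  [/\ c x + d *m jacobian c x = 0, lev (- x) d & lev d (xu - x)].

Definition qp_solution (R : realType) (n m : nat) (r : 'rV[R]_n -> R)
    (c : 'rV[R]_n -> 'rV[R]_m) (xu x g : 'rV[R]_n) (a : R) (d : 'rV[R]_n) :
    Prop :=
  qp_feasible c xu x d /\
  forall d', qp_feasible c xu x d' ->
    qp_objective r x g a d <= qp_objective r x g a d'.

Definition qp_multipliers (R : realType) (n m : nat)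
    (c : 'rV[R]_n -> 'rV[R]_m) (xu x g : 'rV[R]_n) (a : R) (d : 'rV[R]_n)
    (ml : 'rV[R]_m) (zl zu : 'rV[R]_n) : Prop :=
  [/\ lev 0 zl, lev 0 zu,
      g + a *: d - ml *m (jacobian c x)^T - zl + zu = 0,
      forall i, zl 0 i * (x + d) 0 i = 0
    & forall i, zu 0 i * (x + d - xu) 0 i = 0].

(* Predicted decrease for the step b d_k: it is delta_k for b = 1 and         *)
(* delta_k^beta for b = beta_k.                                               *)
Definition pred_decrease (R : realType) (n m : nat) (s : iterates R n m)
    (k : nat) (b : R) : R :=
  - b * dot (g s k) (d s k)
  - 2^-1 * b ^+ 2 * alpha s k * norm2 (d s k) ^+ 2.

Definition decrease_gap (R : realType) (n m : nat) (r : 'rV[R]_n -> R)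
    (s : iterates R n m) (etap etam : R) (k : nat) (b : R) : R :=
  let delta := pred_decrease s k b in
  r (xs s k) - r (xs s k + b *: d s k)
  - (if 0 <= delta then etap else etam) * delta.

Definition rho (R : realType) (n m : nat) (r : 'rV[R]_n -> R)
    (C : constants R) (s : iterates R n m) (k : nat) : R :=
  decrease_gap r s (eta_lp C) (eta_lm C) k 1.

Definition rho_beta (R : realType) (n m : nat) (r : 'rV[R]_n -> R)
    (C : constants R) (s : iterates R n m) (k : nat) : R :=
  decrease_gap r s (eta_gp C) (eta_gm C) k (beta s k).

Definition line_search_test (R : realType) (n m : nat)
    (c : 'rV[R]_n -> 'rV[R]_m) (C : constants R) (s : iterates R n m)
    (k : nat) (b : R) : Prop :=
  theta s k * norm1 (c (xs s k + b *: d s k))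
    - eta_beta C * 2^-1 * alpha s k * b * norm2 (d s k) ^+ 2
  <= theta s k * norm1 (c (xs s k))
    - eta_gm C * b * `|dot (ml s k) (c (xs s k))|.

Definition is_line_search_step (R : realType) (n m : nat)
    (c : 'rV[R]_n -> 'rV[R]_m) (C : constants R) (s : iterates R n m)
    (k : nat) : Prop :=
  exists j : nat,
    [/\ beta s k = 2^-1 ^+ j,
        line_search_test c C s k (2^-1 ^+ j)
      & forall i, (i < j)%N -> ~ line_search_test c C s k (2^-1 ^+ i)].

Definition serious (R : realType) (n m : nat) (r : 'rV[R]_n -> R)
    (C : constants R) (s : iterates R n m) (k : nat) : Prop :=
  0 < rho r C s k /\ 0 <= rho_beta r C s k.

Definition rejected (R : realType) (n m : nat) (r : 'rV[R]_n -> R)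
    (C : constants R) (s : iterates R n m) (k : nat) : Prop :=
  rho r C s k <= 0 \/ (0 < rho r C s k /\ rho_beta r C s k < 0).

(* s is an infinite run, i.e. one on which the stopping test with tolerance   *)
(* epsilon = 0 never succeeds.                                                *)
Record algorithmA_run (R : realType) (n m : nat) (r : 'rV[R]_n -> R)
    (c : 'rV[R]_n -> 'rV[R]_m) (xu : 'rV[R]_n) (C : constants R)
    (s : iterates R n m) : Prop := {
  run_x0 : lev 0 (xs s 0) /\ lev (xs s 0) xu;
  run_alpha0 : 0 < alpha s 0;
  run_theta_init : 0 < theta_init s;
  run_subgradient : forall k, clarke_subdiff r (xs s k) (g s k);
  run_qp : forall k, qp_solution r c xu (xs s k) (g s k) (alpha s k) (d s k);
  run_multipliers : forall k,
    qp_multipliers c xu (xs s k) (g s k) (alpha s k) (d s k)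
                   (ml s k) (zl s k) (zu s k);
  run_nonstop : forall k, ~ (norm2 (d s k) <= 0);
  run_theta : forall k,
    theta s k = Num.max (if k is k'.+1 then theta s k' else theta_init s)
                        (eta_gm C * `|ml s k| + gam C);
  run_beta : forall k, 0 < rho r C s k -> is_line_search_step c C s k;
  run_serious : forall k, serious r C s k ->
    xs s k.+1 = xs s k + beta s k *: d s k /\ alpha s k.+1 = alpha s k;
  run_rejected : forall k, rejected r C s k ->
    xs s k.+1 = xs s k /\ alpha s k.+1 = eta_alpha C * alpha s k }.

(* Main.v *)
(* Upper-C^2 makes r locally semiconcave up to a quadratic; fed into Clarke's
   limsup this gives r x - r z - <g, x - z> <= K |x - z|^2 for subgradients g at
   z near a given point and x close to z, while for x far from z the Lipschitz
   bound is enough.  Compactness of the box makes K uniform.  Once alpha_k > 2K,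
   the model overestimates r along d_k, so both acceptance tests hold for every
   step length.  Each rejection multiplies alpha by eta_alpha > 1, so alpha_k is
   bounded and only finitely many rejections can occur. *)

Require Import Defs.
From mathcomp Require Import all_boot all_order all_algebra.
From mathcomp Require Import all_classical all_reals all_analysis.
From mathcomp Require Import ring lra.
Import Order.TTheory GRing.Theory Num.Theory.
Import numFieldNormedType.Exports.
Local Open Scope classical_set_scope.
Local Open Scope ring_scope.
Set Implicit Arguments.
Unset Strict Implicit.
Unset Printing Implicit Defensive.

(** * Neighbourhoods as balls, and mean value estimates on the real line *)

Lemma nbhs_radius (R : realType) (V : normedModType R) (x : V) (P : set V) :
  nbhs x P -> exists2 e : R, 0 < e & forall y, `|y - x| < e -> P y.
Proof.
move=> /nbhs_normP[e e0 eP]; exists e => // y yx.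
by apply: eP; rewrite /= distrC.
Qed.

Lemma nbhs_lt_radius (R : realType) (V : normedModType R) (x : V) (rad : R) :
  0 < rad -> \forall y \near x, `|y - x| < rad.
Proof.
by move=> rad0; apply/nbhs_normP; exists rad => // y /=; rewrite distrC.
Qed.

Lemma MVT_closed (R : realType) (q q' : R -> R) (a b : R) :
  a < b -> (forall s : R, a <= s <= b -> is_derive s 1 q (q' s)) ->
  exists2 s, a <= s <= b & q b - q a = q' s * (b - a).
Proof.
move=> ab dq.
have [||s] := MVT ab (f := q) (df := q').
- by move=> s; rewrite in_itv /= => /andP[sa sb]; apply: dq; rewrite !ltW.
- apply: derivable_within_continuous => s; rewrite in_itv /= => /dq ds.
  exact: ex_derive.
- by rewrite in_itv /= => /andP[sa sb] sE; exists s; rewrite ?(ltW sa) ?(ltW sb).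
Qed.

(** The mean value theorem on [[0, t]] and on [[t, 1]] yields two slopes of [q]; a third
    application, to [q1], bounds their difference by [K]. The defect is thus at most
    [t * (1 - t) * K]. Only the factor [t] is kept, as the defect will be divided by [t] in Clarke's
    quotient. *)
Lemma semiconcave_line (R : realType) (q q1 q2 : R -> R) (K t : R) :
  (forall s : R, 0 <= s <= 1 -> is_derive s 1 q (q1 s)) ->
  (forall s : R, 0 <= s <= 1 -> is_derive s 1 q1 (q2 s)) ->
  (forall s, 0 <= s <= 1 -> q2 s <= K) -> 0 <= K -> 0 < t < 1 ->
  (1 - t) * q 0 + t * q 1 <= q t + K * t.
Proof.
move=> dq dq1 q2K K0 /andP[t0 t1].
have [s /andP[s0 st] sE] : exists2 s, 0 <= s <= t & q t - q 0 = q1 s * (t - 0).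
  by apply: MVT_closed => // s /andP[s0 st]; apply: dq; lra.
have [u /andP[tu u1] uE] : exists2 u, t <= u <= 1 & q 1 - q t = q1 u * (1 - t).
  by apply: MVT_closed => // u /andP[? ?]; apply: dq; lra.
have su : q1 u - q1 s <= K.
  have [->|su] := eqVneq s u; first by rewrite subrr.
  have {}su : s < u by rewrite lt_neqAle su (le_trans st).
  have [w /andP[sw wu] ->] : exists2 w, s <= w <= u &
      q1 u - q1 s = q2 w * (u - s).
    by apply: MVT_closed => // w /andP[? ?]; apply: dq1; lra.
  have w01 : 0 <= w <= 1 by lra.
  have := q2K _ w01; nra.
have H : (1 - t) * (q t - q 0) - t * (q 1 - q t) = (t * (1 - t)) * (q1 s - q1 u).
  by rewrite sE uE; ring.
have P : 0 <= t * (1 - t) by nra.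
have Q : (t * (1 - t)) * (q1 u - q1 s) <= (t * (1 - t)) * K by rewrite ler_wpM2l.
have Q2 : t * (1 - t) * K <= t * K by rewrite ler_wpM2r//; nra.
nra.
Qed.

(** * Strict directional derivatives *)

Section StrictDerivative.
Variables (R : realType) (V : normedModType R).
Implicit Types (f : V -> R) (x v : V).

Lemma is_derive_line f x v (s : R) :
  derivable f (x + s *: v) v ->
  is_derive s 1 (fun u : R => f (x + u *: v)) ('D_v f (x + s *: v)).
Proof.
have E : (fun h : R => h^-1 *: (((fun u : R => f (x + u *: v)) \o shift s)
       (h *: 1) - f (x + s *: v)))
   = (fun h => h^-1 *: ((f \o shift (x + s *: v)) (h *: v) - f (x + s *: v))).
  apply/funext => h; rewrite /shift /= [_ *: 1]mulr1 scalerDl.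
  by rewrite addrCA.
move=> df; split; first by rewrite /derivable E.
by rewrite /derive E.
Qed.

(* The base point also varies: this is what makes the notion additive in the
   direction, hence computable from continuous partial derivatives. *)
Definition strict_deriv f x v (l : R) := forall e, 0 < e ->
  exists2 rad, 0 < rad & forall y (h : R), `|y - x| < rad -> `|h| < rad ->
    `|f (y + h *: v) - f y - h * l| <= e * `|h|.

Lemma strict_deriv_derive f x v l :
  strict_deriv f x v l -> derivable f x v /\ 'D_v f x = l.
Proof.
move=> sf.
have : h^-1 *: ((f \o shift x) (h *: v) - f x) @[h --> 0^'] --> l.
  apply/cvgrPdist_le => e e0; have [rad rad0 radP] := sf e e0.
  near=> h; rewrite /shift /= distrC [h *: v + x]addrC.
  have h0 : h != 0 by near: h; exact: nbhs_dnbhs_neq.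
  have hr : `|h| < rad.
    near: h; apply: nbhs_dnbhs; apply/nbhs_normP; exists rad => //= h /=.
    by rewrite sub0r normrN.
  have -> : h^-1 *: (f (x + h *: v) - f x) - l
      = h^-1 * (f (x + h *: v) - f x - h * l).
    by rewrite [RHS]mulrBr mulKf.
  rewrite normrM normfV mulrC ler_pdivrMr ?normr_gt0//.
  by apply: radP; rewrite ?subrr ?normr0.
move=> cf; split; last exact: cvg_lim cf.
by apply/cvg_ex; exists l.
Unshelve. all: by end_near. Qed.

Lemma strict_deriv0 f x : strict_deriv f x 0 0.
Proof.
move=> e e0; exists 1 => // y h _ _.
by rewrite scaler0 addr0 subrr mulr0 subrr normr0 mulr_ge0// ltW.
Qed.

(** The increment is split at [y + h *: v]. The estimate along [w] is then needed at this displaced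
    base point, which is exactly what strictness provides. *)
Lemma strict_derivD f x v w l k :
  strict_deriv f x v l -> strict_deriv f x w k ->
  strict_deriv f x (v + w) (l + k).
Proof.
move=> fv fw e e0.
have e2 : 0 < e / 2 by rewrite divr_gt0.
have [a a0 aP] := fv _ e2; have [b b0 bP] := fw _ e2.
pose c := Num.min a b; have c0 : 0 < c by rewrite lt_min a0.
pose M := 1 + `|v|; have M0 : 0 < M by rewrite ltr_pwDl.
have M1 : 1 <= M by rewrite lerDl.
(* With this radius [|y - x| + |h| * |v|] stays below [c], so the displaced base point remains
   admissible. *)
exists (c / (2 * M)); first by rewrite divr_gt0// mulr_gt0.
move=> y h; rewrite !ltr_pdivlMr ?mulr_gt0// => yx hc.
have ca : c <= a by rewrite ge_min lexx.
have cb : c <= b by rewrite ge_min lexx orbT.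
have yn := normr_ge0 (y - x); have hn := normr_ge0 h; have vn := normr_ge0 v.
have -> : f (y + h *: (v + w)) - f y - h * (l + k)
   = (f (y + h *: v + h *: w) - f (y + h *: v) - h * k)
     + (f (y + h *: v) - f y - h * l).
  by rewrite scalerDr addrA; ring.
apply: (le_trans (ler_normD _ _)).
rewrite [e]splitr mulrDl; apply: lerD.
- apply: bP; last by nra.
  have -> : y + h *: v - x = (y - x) + h *: v by rewrite addrAC.
  apply: le_lt_trans (ler_normD _ _) _; rewrite normrZ.
  rewrite /M in yx hc M1; nra.
- by apply: aP; nra.
Qed.

Lemma strict_derivZ f x v l a :
  strict_deriv f x v l -> strict_deriv f x (a *: v) (a * l).
Proof.
have [->|a0] := eqVneq a 0.
  by rewrite scale0r mul0r => _; exact: strict_deriv0.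
move=> fv e e0; have an : 0 < `|a| by rewrite normr_gt0.
have [b b0 bP] := fv (e / `|a|) (divr_gt0 e0 an).
pose c := Num.min b (b / `|a|).
have c0 : 0 < c by rewrite lt_min b0 divr_gt0.
exists c => // y h; rewrite !lt_min => /andP[yb _] /andP[_ hb].
rewrite ltr_pdivlMr// in hb.
have := bP y (h * a) yb; rewrite normrM => /(_ hb).
by rewrite scalerA [`|h| * `|a|]mulrC !mulrA divfK ?normr_eq0.
Qed.

(** For either sign of [h], the mean value theorem on the segment from [y] to [y + h *: v] turns the
    increment into [h] times a derivative at an intermediate point. That point is close to [x], so
    continuity of ['D_v f] at [x] gives the error bound. *)
Lemma strict_deriv_cont f x v :
  (\forall y \near x, derivable f y v) ->
  {for x, continuous ('D_v f)} -> strict_deriv f x v ('D_v f x).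
Proof.
move=> df cf e e0.
have cfe : \forall y \near x, `|'D_v f x - 'D_v f y| <= e.
  by move/cvgrPdist_le: cf; exact.
have [rad rad0 radP] := nbhs_radius (filterI df cfe).
pose M := 1 + `|v|; have M0 : 0 < M by rewrite ltr_pwDl.
exists (rad / (2 * M)); first by rewrite divr_gt0// mulr_gt0.
move=> y h; rewrite !ltr_pdivlMr ?mulr_gt0// => yx hc.
have vn := normr_ge0 v; have yn := normr_ge0 (y - x).
have close (s : R) : `|s| <= `|h| -> `|y + s *: v - x| < rad.
  move=> sh; have sn := normr_ge0 s.
  have -> : y + s *: v - x = (y - x) + s *: v by rewrite addrAC.
  apply: le_lt_trans (ler_normD _ _) _; rewrite normrZ.
  rewrite /M in yx hc; nra.
have dl (s : R) : `|s| <= `|h| ->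
    is_derive s 1 (fun u : R => f (y + u *: v)) ('D_v f (y + s *: v)).
  by move=> /close/radP[dfs _]; exact: is_derive_line.
have [s sh ->] : exists2 s, `|s| <= `|h| &
    f (y + h *: v) - f y = 'D_v f (y + s *: v) * h.
  have [h0|h0|->] := ltgtP h 0.
  - have [|s /andP[hs s0] sE] := MVT_closed h0 (q := fun u : R => f (y + u *: v))
      (q' := fun s => 'D_v f (y + s *: v)).
      by move=> s /andP[hs s0]; apply: dl; rewrite !ler0_norm// ?(ltW h0) ?lerN2.
    exists s; first by rewrite !ler0_norm// ?(ltW h0) ?lerN2.
    by rewrite scale0r addr0 sub0r mulrN in sE; rewrite -opprB sE opprK.
  - have [|s /andP[hs s0] sE] := MVT_closed h0 (q := fun u : R => f (y + u *: v))
      (q' := fun s => 'D_v f (y + s *: v)).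
      by move=> s /andP[hs s0]; apply: dl; rewrite !ger0_norm// ?(ltW h0).
    exists s; first by rewrite !ger0_norm// ?(ltW h0).
    by rewrite scale0r addr0 subr0 in sE.
  - by exists 0; rewrite // scale0r addr0 subrr mulr0.
have [_ fs] := radP _ (close _ sh).
by rewrite [_ * h]mulrC -mulrBr normrM mulrC distrC ler_wpM2r.
Qed.

End StrictDerivative.

(** * From continuous partial derivatives to semiconcavity of upper-C2 functions *)

Section Partials.
Variables (R : realType) (n : nat).
Implicit Types (f : 'rV[R]_n -> R) (x y v : 'rV[R]_n).

(** The direction is expanded in the canonical basis and assembled one coordinate at a time by
    additivity and homogeneity of strict derivatives; plain directional derivatives would not add
    up. *)
Lemma strict_deriv_partial f x v :
  (forall i, \forall y \near x, derivable f y (delta_mx 0 i)) ->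
  (forall i, {for x, continuous (partial i f)}) ->
  strict_deriv f x v (\sum_i v 0 i * partial i f x).
Proof.
move=> df cf; rewrite [X in strict_deriv _ _ X]row_sum_delta.
elim/big_rec2 : _ => [|i l w _ IH]; first exact: strict_deriv0.
apply: strict_derivD IH; apply: strict_derivZ.
exact: (strict_deriv_cont (df i) (cf i)).
Qed.

Lemma is_derive_line_partial f (U : set 'rV[R]_n) y v (s : R) :
  open U -> U (y + s *: v) ->
  (forall i x, U x -> derivable f x (delta_mx 0 i)) ->
  (forall i x, U x -> {for x, continuous (partial i f)}) ->
  is_derive s 1 (fun u : R => f (y + u *: v))
    (\sum_i v 0 i * partial i f (y + s *: v)).
Proof.
move=> oU Us df cf; have Un : nbhs (y + s *: v) U by exact: open_nbhs_nbhs.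
have [|dv <-] := @strict_deriv_derive _ _ f (y + s *: v) v
    (\sum_i v 0 i * partial i f (y + s *: v)).
  apply: strict_deriv_partial => i; last exact: cf.
  by apply: filterS Un => x; exact: df.
exact: is_derive_line.
Qed.

(** A tube argument: near each [t] the bound [|F t x0| + 1] works on a product neighbourhood, and
    compactness merges these. Letting the bound vary along [+oo] in the filter lets the
    neighbourhood and the constant be found together. *)
Lemma bounded_near_compact (T : topologicalType) (F : T -> 'rV[R]_n -> R) x0 :
  compact [set: T] ->
  (forall t, {for (t, x0), continuous (fun z : T * 'rV[R]_n => F z.1 z.2)}) ->
  \forall z \near filter_prod (nbhs x0) +oo, forall t, `|F t z.1| <= z.2.
Proof.
move=> /compact_near_coveringP cT cF.
suff: \forall z \near filter_prod (nbhs x0) +oo, [set: T] `<=`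
    (fun t => `|F t z.1| <= z.2) by apply: filterS => z zP t; exact: zP.
apply: cT => t _.
have ct : \forall z \near (t, x0), `|F z.1 z.2| <= `|F t x0| + 1.
  have /cvgrPdist_le/(_ 1 ltr01) := cF t; apply: filterS => z /= zP.
  rewrite -lerBlDl; apply: le_trans zP; rewrite distrC.
  exact: lerB_dist.
have [[A B] [At Bx] AB] := ct.
exists (A, (B `*` [set M | `|F t x0| + 1 <= M])) => /=.
  split => //; exists (B, [set M | `|F t x0| + 1 <= M]) => //=; split => //.
  exact: nbhs_pinfty_ge.
move=> [u [x M]] /= [Au [Bx' tM]]; apply: le_trans tM.
exact: (AB (u, x)).
Qed.

Lemma cvg_jointly (T : topologicalType) (F : T -> 'rV[R]_n -> R) t x :
  {for (t, x), continuous (fun z : T * 'rV[R]_n => F z.1 z.2)} ->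
  {for x, continuous (F t)}.
Proof.
move=> cF; have FF : Filter (nbhs x) by exact: nbhs_filter.
exact: (continuous2_cvg FF cF (cvg_cst t) cvg_id).
Qed.

Lemma coord_le_norm v i : `|v 0 i| <= `|v|.
Proof.
rewrite [X in _ <= X]mx_normrE.
exact: (le_bigmax _ (fun ij => `|v ij.1 ij.2|) (0, i)).
Qed.

Lemma norm_segment x0 y v (rad s : R) : 0 <= s <= 1 ->
  `|y - x0| < rad -> `|y + v - x0| < rad -> `|y + s *: v - x0| < rad.
Proof.
move=> /andP[s0 s1] ya yb.
have -> : y + s *: v - x0 = (1 - s) *: (y - x0) + s *: (y + v - x0).
  by apply/rowP => i; rewrite !mxE; ring.
apply: le_lt_trans (ler_normD _ _) _; rewrite !normrZ.
rewrite ger0_norm ?subr_ge0// (ger0_norm s0).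
have : Num.max `|y - x0| `|y + v - x0| < rad by rewrite gt_max ya.
apply: le_lt_trans.
set M := Num.max _ _.
have aM : `|y - x0| <= M by rewrite le_max lexx.
have bM : `|y + v - x0| <= M by rewrite le_max lexx orbT.
nra.
Qed.

(* [r] lies below the branch [p t] that is active at the intermediate point,
   so the second-order bound on that branch transfers to [r]. *)
Lemma upper_C2_semiconcave (r : 'rV[R]_n -> R) x0 : upper_C2 r ->
  exists rad K, [/\ 0 < rad, 0 <= K &
    forall y v s, `|y - x0| < rad -> `|y + v - x0| < rad -> 0 < s < 1 ->
      (1 - s) * r y + s * r (y + v) <= r (y + s *: v) + K * `|v| ^+ 2 * s].
Proof.
move=> /(_ x0)[V [T [p [oV Vx0 cT [_ dp cp dpp cpp] rp]]]].
have bnd : \forall z \near filter_prod (nbhs x0) +oo,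
    forall ij : 'I_n * 'I_n, forall t,
      `|partial ij.2 (partial ij.1 (p t)) z.1| <= z.2.
  apply: filter_forall => -[i j] /=.
  apply: (bounded_near_compact (F := fun t => partial j (partial i (p t)))) => // t.
  exact: cpp.
have [[A B] [Ax BM] AB] := bnd.
have nA : nbhs x0 (A `&` V) by apply: filterI => //; exact: open_nbhs_nbhs.
have [rad rad0 radP] := nbhs_radius nA.
have [M [M0 BM']] : exists M, 0 <= M /\ B M.
  have [M [MM]] := filter_ex (filterI BM (nbhs_pinfty_ge (num_real 0))).
  by exists M.
(* The second derivative along [v] is a sum of [n ^ 2] terms, each at most [M * |v| ^ 2] in absolute
   value. *)
exists rad, (M * n%:R ^+ 2); split => //; first by rewrite mulr_ge0// exprn_ge0.
move=> y v s ya yb s01.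
have U u : 0 <= u <= 1 -> (A `&` V) (y + u *: v).
  by move=> u01; apply/radP/norm_segment.
have s01' : 0 <= s <= 1 by case/andP: s01 => ? ?; rewrite !ltW.
have [_ /rp[[t rt] _]] := U s s01'.
have pder i x : V x -> derivable (p t) x (delta_mx 0 i) by exact: dp.
have ppart i x : V x -> {for x, continuous (partial i (p t))}.
  by move=> Vx; apply: (cvg_jointly (F := fun t => partial i (p t))); exact: cp.
pose q u := p t (y + u *: v).
pose q1 u := \sum_i v 0 i * partial i (p t) (y + u *: v).
pose q2 u := \sum_i v 0 i *
  \sum_j v 0 j * partial j (partial i (p t)) (y + u *: v).
have dq (u : R) : 0 <= u <= 1 -> is_derive u 1 q (q1 u).
  move=> /U[_ Vu]; exact: (is_derive_line_partial oV Vu pder ppart).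
have dq1 (u : R) : 0 <= u <= 1 -> is_derive u 1 q1 (q2 u).
  move=> /U[_ Vu].
  have -> : q1 = \sum_i v 0 i *: (fun u => partial i (p t) (y + u *: v)).
    by apply/funext => w; rewrite fct_sumE.
  apply: is_derive_sum => i; apply: is_deriveZ.
  apply: (is_derive_line_partial oV Vu) => j x Vx; first exact: dpp.
  apply: (cvg_jointly (F := fun t => partial j (partial i (p t)))); exact: cpp.
have q2M (u : R) : 0 <= u <= 1 -> q2 u <= M * n%:R ^+ 2 * `|v| ^+ 2.
  move=> /U[Au _]; apply: le_trans (ler_norm _) _.
  have vp : 0 <= `|v| := normr_ge0 v.
  have ppM i j : `|partial j (partial i (p t)) (y + u *: v)| <= M.
    exact: (AB (_, M) (conj Au BM') (i, j) t).
  have sum_le (F : 'I_n -> R) (c : R) : (forall i, `|F i| <= c) ->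
      `|\sum_i v 0 i * F i| <= n%:R * (`|v| * c).
    move=> Fc; apply: le_trans (ler_norm_sum _ _ _) _.
    rewrite mulr_natl -[X in _ *+ X]card_ord -sumr_const; apply: ler_sum => i _.
    by rewrite normrM ler_pM// coord_le_norm.
  apply: le_trans (sum_le _ (n%:R * (`|v| * M)) _) _.
    by move=> i; apply: sum_le.
  by rewrite le_eqVlt; apply/orP; left; apply/eqP; ring.
have [Vy Vyv] : V y /\ V (y + v).
  have [|_] := U 0; rewrite ?lexx ?ler01// scale0r addr0.
  by have [|_] := U 1; rewrite ?lexx ?ler01// scale1r.
have [_ /(_ t) ry] := rp _ Vy; have [_ /(_ t) ryv] := rp _ Vyv.
have K0 : 0 <= M * n%:R ^+ 2 * `|v| ^+ 2 by rewrite !mulr_ge0// exprn_ge0.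
have := semiconcave_line dq dq1 q2M K0 s01.
rewrite /q scale0r addr0 scale1r -rt; apply: le_trans.
by case/andP: s01 => s0 s1; apply: lerD; rewrite ler_wpM2l// ?subr_ge0 ltW.
Qed.

End Partials.

(** * Quadratic upper estimate for Clarke subgradients *)

Section Clarke.
Variables (R : realType) (n : nat).
Implicit Types (r : 'rV[R]_n -> R) (x y z v g : 'rV[R]_n).

(** The limsup is an infimum over neighbourhoods of suprema, so for each [e] one product
    neighbourhood suffices. *)
Lemma clarke_dd_le r x v (c : R) :
  (forall e, 0 < e -> exists2 rad, 0 < rad & forall y t, `|y - x| < rad ->
     0 < t < rad -> r (y + t *: v) - r y <= t * (c + e)) ->
  (clarke_dd r x v <= c%:E)%E.
Proof.
move=> H; apply/lee_addgt0Pr => e /H[rad rad0 radP].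
rewrite -EFinD /clarke_dd /limf_esup; apply: ge_ereal_inf.
pose U := [set y | `|y - x| < rad] `*` [set t : R | 0 < t < rad].
have nx : nbhs x [set y | `|y - x| < rad].
  exact: (nbhs_lt_radius x rad0).
have n0 : (0 : R)^'+ [set t : R | 0 < t < rad].
  near=> t; apply/andP; split; near: t; [exact: nbhs_right_gt|exact: nbhs_right_lt].
eexists.
  by exists U; [exists ([set y | `|y - x| < rad], [set t : R | 0 < t < rad])|].
apply: ge_ereal_sup => _ [[y t] [/= yx tr] <-]; rewrite lee_fin ler_pdivrMr.
  by rewrite mulrC; exact: radP.
by case/andP: tr.
Unshelve. all: by end_near. Qed.

Lemma dotN g v : dot g (- v) = - dot g v.
Proof. by rewrite /dot -sumrN; apply: eq_bigr => i _; rewrite mxE mulrN. Qed.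

Lemma dotZ g v (a : R) : dot g (a *: v) = a * dot g v.
Proof. by rewrite /dot mulr_sumr; apply: eq_bigr => i _; rewrite mxE mulrCA. Qed.

Lemma subgradient_lipschitz r (L : R) x g v :
  (forall x y, `|r x - r y| <= L * `|x - y|) ->
  clarke_subdiff r x g -> dot g v <= L * `|v|.
Proof.
move=> rL /(_ v) gv; rewrite -lee_fin; apply: le_trans gv _.
apply: clarke_dd_le => e e0; exists 1 => // y t _ /andP[t0 _].
apply: le_trans (ler_norm _) _; apply: le_trans (rL _ _) _.
have -> : y + t *: v - y = t *: v by rewrite addrAC subrr add0r.
rewrite normrZ gtr0_norm// mulrCA ler_wpM2l// ?lerDl ltW//.
Qed.

(** The subgradient is tested in direction [- v]. With [A = y - t *: v], the point [y] lies at
    parameter [t] on the segment from [A] to [A + v], so semiconcavity bounds [r A - r y] by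
    [t * (r A - r (A + v) + K * |v| ^ 2)]. Lipschitz continuity then replaces [A] by [z] at a cost
    vanishing in the limsup. *)
Lemma subgradient_semiconcave r (L rad K : R) x0 z v g :
  (forall x y, `|r x - r y| <= L * `|x - y|) -> 0 <= L ->
  (forall y v s, `|y - x0| < rad -> `|y + v - x0| < rad -> 0 < s < 1 ->
      (1 - s) * r y + s * r (y + v) <= r (y + s *: v) + K * `|v| ^+ 2 * s) ->
  `|z - x0| < rad / 4 -> `|v| < rad / 4 -> clarke_subdiff r z g ->
  r (z + v) - r z - dot g v <= K * `|v| ^+ 2.
Proof.
move=> rL L0 rK zx0 vr /(_ (- v)); rewrite dotN => gv.
have rad0 : 0 < rad by have := normr_ge0 v; lra.
rewrite lerBlDr -lerBlDl -lerN2 opprD opprB addrC -lee_fin.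
apply: le_trans gv _; apply: clarke_dd_le => e e0.
(* [W] is fitted to the cost [2 * L * |A - z|] of moving both end points, so that [a * W <= e]
   absorbs it; [L + 1] keeps [W] positive when [L = 0]. The quarter radii keep [A] and [A + v]
   within [rad] of [x0]. *)
pose W := 2 * (L + 1) * (1 + `|v|).
have L1 : 0 < L + 1 by rewrite ltr_wpDl.
have v1 : 0 < 1 + `|v| by rewrite ltr_pwDl.
have W0 : 0 < W by rewrite !mulr_gt0.
pose a := Num.min (Num.min (rad / 4) 1) (e / W).
have a0 : 0 < a by rewrite !lt_min !divr_gt0// ltr01.
exists a => // y t yz /andP[t0 ta].
have [a1 a2 a3] : [/\ a <= rad / 4, a <= 1 & a * W <= e].
  by rewrite -ler_pdivlMr// /a !ge_min !lexx ?orbT.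
pose A := y - t *: v.
have Az : `|A - z| <= `|y - z| + t * `|v|.
  rewrite /A addrAC; apply: le_trans (ler_normB _ _) _.
  by rewrite normrZ gtr0_norm.
have Ax0 : `|A - x0| <= `|A - z| + `|z - x0|.
  by rewrite -[A - x0](subrKA z); apply: ler_normD.
have Avx0 : `|A + v - x0| <= `|A - x0| + `|v|.
  by rewrite addrAC; apply: ler_normD.
have vn := normr_ge0 v; have yzn := normr_ge0 (y - z).
have tv : t * `|v| <= `|v| by rewrite ler_piMl//; lra.
have := rK A v t; rewrite subrK.
have -> : `|A - x0| < rad by lra.
have -> : `|A + v - x0| < rad by lra.
have -> : 0 < t < 1 by lra.
move=> /(_ isT isT isT) semi.
have := rL A z; have := rL (A + v) (z + v).
have -> : A + v - (z + v) = A - z by rewrite opprD addrACA subrr addr0.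
rewrite !ler_norml => /andP[r1 _] /andP[_ r2].
have Aza : 2 * (L * `|A - z|) <= e.
  apply: le_trans a3; rewrite /W.
  have : `|A - z| <= a * (1 + `|v|) by nra.
  have : 0 <= a * (1 + `|v|) by rewrite ltW// mulr_gt0.
  set P := a * (1 + `|v|) => P0 dP.
  have -> : a * (2 * (L + 1) * (1 + `|v|)) = 2 * (L * P) + 2 * P.
    by rewrite /P; ring.
  have := ler_wpM2l L0 dP; lra.
have -> : y + t *: - v = A by rewrite scalerN.
have : t * (r A - r (A + v) + K * `|v| ^+ 2) <=
       t * (r z - r (z + v) + K * `|v| ^+ 2 + e).
  by rewrite ler_wpM2l ?(ltW t0)//; lra.
nra.
Qed.

Lemma subgradient_estimate_near r (L : R) x0 :
  (forall x y, `|r x - r y| <= L * `|x - y|) -> 0 <= L -> upper_C2 r ->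
  exists K, \forall z \near x0, forall x g, clarke_subdiff r z g ->
    r x - r z - dot g (x - z) <= K * `|x - z| ^+ 2.
Proof.
move=> rL L0 /(upper_C2_semiconcave x0)[rad [K [rad0 K0 rK]]].
pose e := rad / 4; have e0 : 0 < e by rewrite divr_gt0.
(* [K] serves when [|x - z| < e]. Farther away, the Lipschitz bound [2 * L * |x - z|] is at most
   [2 * L / e * |x - z| ^ 2]. *)
exists (K + 2 * L / e); near=> z => x g gz.
have zx0 : `|z - x0| < e.
  near: z; exact: (nbhs_lt_radius x0 e0).
have D0 : 0 <= 2 * L / e by rewrite divr_ge0 ?mulr_ge0// ltW.
rewrite mulrDl; have [xz|xz] := ltP `|x - z| e.
  apply: ler_wpDr; first by rewrite mulr_ge0// exprn_ge0.
  have := subgradient_semiconcave rL L0 rK zx0 xz gz.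
  by rewrite [z + _]addrC subrK.
apply: ler_wpDl; first by rewrite mulr_ge0// exprn_ge0.
have /ler_normlP[_ r1] := rL x z.
have := subgradient_lipschitz (- (x - z)) rL gz; rewrite dotN normrN => gx.
apply: (@le_trans _ _ (2 * L * `|x - z|)); first lra.
have -> : 2 * L / e * `|x - z| ^+ 2 = 2 * L * `|x - z| * (`|x - z| / e).
  by ring.
by rewrite ler_peMr ?mulr_ge0// ler_pdivlMr// mul1r.
Unshelve. all: by end_near. Qed.

(** The estimate is monotone in [K], so it holds eventually as [K] grows near each point, and
    compactness of [A] makes one [K] valid throughout. *)
Lemma subgradient_estimate r (L : R) (A : set 'rV[R]_n) :
  (forall x y, `|r x - r y| <= L * `|x - y|) -> 0 <= L -> upper_C2 r ->
  compact A ->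
  exists K, forall z, A z -> forall x g, clarke_subdiff r z g ->
    r x - r z - dot g (x - z) <= K * `|x - z| ^+ 2.
Proof.
move=> rL L0 rC2 /compact_near_coveringP cA.
suff H : \forall K \near +oo, A `<=` (fun z => forall x g,
    clarke_subdiff r z g -> r x - r z - dot g (x - z) <= K * `|x - z| ^+ 2).
  have [K KA] := filter_ex H; by exists K => z Az; exact: KA.
apply: cA => z0 _.
have [K Kz] := subgradient_estimate_near z0 rL L0 rC2.
near=> z M.
have KM : K <= M by near: M; apply: nbhs_pinfty_ge; rewrite num_real.
have zK : forall x g, clarke_subdiff r z g ->
  r x - r z - dot g (x - z) <= K * `|x - z| ^+ 2 by near: z.
move=> x g /(zK x)/le_trans; apply.
by rewrite ler_wpM2r ?exprn_ge0.
Unshelve. all: by end_near. Qed.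

Lemma compact_lev_box (l u : 'rV[R]_n) : compact [set x | lev l x /\ lev x u].
Proof.
have := rV_compact (fun i => @segment_compact R (l 0 i) (u 0 i)).
congr compact; apply/seteqP; split => x /=.
  by move=> H; split=> i; have := H i; rewrite in_itv /= => /andP[].
by move=> [lx xu] i; rewrite in_itv /= lx xu.
Qed.

Lemma norm2_sqr v : norm2 v ^+ 2 = \sum_i v 0 i ^+ 2.
Proof. by rewrite sqr_sqrtr// sumr_ge0// => i _; rewrite sqr_ge0. Qed.

(** With [norm2_le_norm], this passes between the infinity-norm of the analysis and the 2-norm of
    the algorithm. *)
Lemma norm_le_norm2 v : `|v| <= norm2 v.
Proof.
have [->|v0] := eqVneq `|v| 0; first exact: sqrtr_ge0.
have [[i j]] := mx_norm_neq0 v0; rewrite ord1 => /= vE.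
rewrite [X in X <= _]vE -sqrtr_sqr ler_wsqrtr// (bigD1 j)//= lerDl.
by rewrite sumr_ge0// => k _; rewrite sqr_ge0.
Qed.

Lemma norm2_le_norm v : norm2 v <= n%:R * `|v|.
Proof.
rewrite -[leRHS]ger0_norm ?mulr_ge0// -sqrtr_sqr ler_wsqrtr//.
apply: (@le_trans _ _ (\sum_(i < n) `|v| ^+ 2)).
  apply: ler_sum => i _; rewrite -real_normK ?num_real// ler_sqr ?nnegrE//.
  exact: coord_le_norm.
rewrite sumr_const card_ord -[_ *+ n]mulr_natl exprMn ler_wpM2r ?exprn_ge0//.
by rewrite -natrX ler_nat expnS expn1; case: (n) => // k; rewrite leq_pmulr.
Qed.

End Clarke.

(** * Invariants of a run, and acceptance for large [alpha] *)

Section Algorithm.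
Variables (R : realType) (n m : nat).
Variables (r : 'rV[R]_n -> R) (c : 'rV[R]_n -> 'rV[R]_m) (xu : 'rV[R]_n).
Variables (C : constants R) (s : iterates R n m).
Hypotheses (C_admissible : admissible C) (s_run : algorithmA_run r c xu C s).

Lemma line_search_step_itv k :
  is_line_search_step c C s k -> 0 < beta s k <= 1.
Proof.
case=> j [-> _ _]; rewrite exprn_gt0 ?invr_gt0//=.
by rewrite exprn_ile1// ?invr_ge0// invf_le1// ler1n.
Qed.

Lemma box_step k (b : R) : 0 <= b <= 1 ->
  lev 0 (xs s k) /\ lev (xs s k) xu ->
  lev 0 (xs s k + b *: d s k) /\ lev (xs s k + b *: d s k) xu.
Proof.
move=> /andP[b0 b1] [x0 x1].
have [[_ dl du] _] := run_qp s_run k.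
split=> i; move: (x0 i) (x1 i) (dl i) (du i); rewrite !mxE => ? ? ? ?; nra.
Qed.

Lemma serious_or_rejected k : serious r C s k \/ rejected r C s k.
Proof.
rewrite /serious /rejected.
have [?|?] := leP (rho r C s k) 0; first by right; left.
by have [?|?] := leP 0 (rho_beta r C s k); [left|right; right].
Qed.

(** This confines the run to a compact set, where the subgradient estimate has a single constant.
    Serious steps stay inside because the box is convex and [0 < beta <= 1]. *)
Lemma iterates_in_box k : lev 0 (xs s k) /\ lev (xs s k) xu.
Proof.
elim: k => [|k IH]; first exact: (run_x0 s_run).
have [sk|rk] := serious_or_rejected k; last by rewrite (run_rejected s_run rk).1.
rewrite (run_serious s_run sk).1; apply: box_step => //.
have /andP[b0 ->] := line_search_step_itv (run_beta s_run sk.1).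
by rewrite ltW.
Qed.

Lemma alpha_gt0 k : 0 < alpha s k.
Proof.
elim: k => [|k IH]; first exact: (run_alpha0 s_run).
have [sk|rk] := serious_or_rejected k; first by rewrite (run_serious s_run sk).2.
rewrite (run_rejected s_run rk).2 mulr_gt0//.
by case: C_admissible => _ _ _ _ [/(lt_trans ltr01)].
Qed.

Lemma alpha_homo : {homo alpha s : k l / (k <= l)%N >-> k <= l}.
Proof.
apply: homo_leq => [//|? ? ?|k]; first exact: le_trans.
have [sk|rk] := serious_or_rejected k; first by rewrite (run_serious s_run sk).2.
rewrite (run_rejected s_run rk).2 ler_peMl// ?(ltW (alpha_gt0 k))//.
by case: C_admissible => _ _ _ _ [/ltW].
Qed.

Lemma dir_norm_gt0 k : 0 < norm2 (d s k).
Proof. by rewrite ltNge; apply/negP/(run_nonstop s_run). Qed.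

Section LargeAlpha.
Variable K : R.
Hypothesis r_estimate : forall z, lev 0 z /\ lev z xu -> forall x g,
  clarke_subdiff r z g -> r x - r z - dot g (x - z) <= K * norm2 (x - z) ^+ 2.

(** The estimate at displacement [b *: d s k] bounds the actual decrease below by the predicted one
    with [alpha / 2] replaced by [K]; as the direction is nonzero, the actual decrease is strictly
    larger. Scaling the prediction by [etap <= 1] when nonnegative, or by [etam >= 1] when negative,
    can only lower it. *)
Lemma decrease_gap_gt0 k (etap etam b : R) : 2 * K < alpha s k ->
  0 < b -> etap <= 1 -> 1 <= etam -> 0 < decrease_gap r s etap etam k b.
Proof.
move=> Ka b0 ep em; rewrite /decrease_gap.
have := r_estimate (iterates_in_box k) (xs s k + b *: d s k) (run_subgradient s_run k).
rewrite [X in dot _ X]addrAC subrr add0r [X in norm2 X]addrAC subrr add0r.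
rewrite dotZ !norm2_sqr.
have -> : \sum_i (b *: d s k) 0 i ^+ 2 = b ^+ 2 * norm2 (d s k) ^+ 2.
  by rewrite norm2_sqr mulr_sumr; apply: eq_bigr => i _; rewrite mxE exprMn.
have := dir_norm_gt0 k.
have : pred_decrease s k b =
  - b * dot (g s k) (d s k) - 2^-1 * b ^+ 2 * alpha s k * norm2 (d s k) ^+ 2.
  by [].
move: (pred_decrease _ _ _) => D DE N0.
have P0 : 0 < b ^+ 2 * norm2 (d s k) ^+ 2 by rewrite mulr_gt0// exprn_gt0.
have : K * (b ^+ 2 * norm2 (d s k) ^+ 2) <
    2^-1 * alpha s k * (b ^+ 2 * norm2 (d s k) ^+ 2) by rewrite ltr_pM2r//; lra.
have : (if 0 <= D then etap else etam) * D <= D.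
  by case: ifPn => D0; [nra|rewrite -ltNge in D0; nra].
move: (_ * D) DE => E; lra.
Qed.

(** The gap bound is used at [b = 1] and then at [b = beta s k]. The order matters: positivity of
    [beta s k] comes from the line search, which is run only once [rho] is positive. *)
Lemma not_rejected k : 2 * K < alpha s k -> ~ rejected r C s k.
Proof.
case: C_admissible => -[/andP[_ lp1]] lm1 [_ _ gp1] gm1 _ Ka.
have r0 : 0 < rho r C s k by apply: decrease_gap_gt0.
case=> [|[_]]; first by rewrite leNgt r0.
have /andP[b0 _] := line_search_step_itv (run_beta s_run r0).
by rewrite ltNge => /negP; apply; rewrite ltW// decrease_gap_gt0.
Qed.

End LargeAlpha.
End Algorithm.

(** * Boundedness of [alpha] and finiteness of the rejections *)

Theorem lemma3p3 (R : realType) (n m : nat)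
    (r : 'rV[R]_n -> R) (c : 'rV[R]_n -> 'rV[R]_m) (xu : 'rV[R]_n)
    (C : constants R) (s : iterates R n m)
    (c_C1 : continuously_differentiable c)
    (r_lipschitz : exists L : R, forall x y, `|r x - r y| <= L * norm2 (x - y))
    (r_upper_C2 : upper_C2 r)
    (C_admissible : admissible C)
    (s_run : algorithmA_run r c xu C s) :
  [/\ finite_set [set k | rejected r C s k],
      exists M : R, forall k, alpha s k <= M
    & exists N : nat, forall k, (N <= k)%N -> alpha s k = alpha s N].
Proof.
have [L rL] := r_lipschitz.
have rL' x y : `|r x - r y| <= (`|L| * n%:R) * `|x - y|.
  apply: le_trans (rL x y) _; rewrite -mulrA.
  apply: (@le_trans _ _ (`|L| * norm2 (x - y))).
    by rewrite ler_wpM2r ?ler_norm// sqrtr_ge0.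
  by rewrite ler_wpM2l// norm2_le_norm.
have [|K0 K0P] := subgradient_estimate rL' _ r_upper_C2 (@compact_lev_box R n 0 xu).
  by rewrite mulr_ge0.
(* Taking [|K0|] makes the constant nonnegative, so that the right-hand side grows when the
   infinity-norm is replaced by the 2-norm. *)
have KP z : lev 0 z /\ lev z xu -> forall x g, clarke_subdiff r z g ->
    r x - r z - dot g (x - z) <= `|K0| * norm2 (x - z) ^+ 2.
  move=> /K0P zK x g /(zK x)/le_trans; apply.
  apply: (@le_trans _ _ (`|K0| * `|x - z| ^+ 2)).
    by rewrite ler_wpM2r ?ler_norm// exprn_ge0.
  by rewrite ler_wpM2l// ler_sqr ?nnegrE ?sqrtr_ge0// norm_le_norm2.
have ahomo := alpha_homo C_admissible s_run.
(* Either [alpha] exceeds the threshold at some [N], after which nothing is rejected and it is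
   frozen at [alpha s N], or the threshold itself is a bound. *)
have [M aM] : exists M, forall k, alpha s k <= M.
  have [[N aN]|aK] := pselect (exists N, 2 * `|K0| < alpha s N).
    exists (alpha s N); elim=> [|k IH]; first exact: ahomo.
    have [kN|Nk] := ltnP k N; first exact: ahomo.
    have nrej : ~ rejected r C s k.
      exact: (not_rejected C_admissible s_run KP) (lt_le_trans aN (ahomo _ _ Nk)).
    have [sk|//] := serious_or_rejected r C s k.
    by rewrite (run_serious s_run sk).2.
  by exists (2 * `|K0|) => k; rewrite leNgt; apply/negP => ak; apply: aK; exists k.
have eta1 : 1 < eta_alpha C by case: C_admissible => _ _ _ _ [].
pose A := range (alpha s); pose S := sup A.
have hA : has_sup A by split; [exists (alpha s 0); exists 0%N|exists M => _ [k _ <-]].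
have aS k : alpha s k <= S by apply: sup_upper_bound => //; exists k.
have S0 : 0 < S := lt_le_trans (alpha_gt0 C_admissible s_run 0) (aS 0%N).
(* The tolerance makes [alpha s N > S / eta_alpha C]; any rejection from [N] on would then lift
   [alpha] above its supremum [S]. The tolerance is positive because [S > 0] and
   [eta_alpha C > 1]. *)
have [|_ [N _ <-] SN] := sup_adherent (eps := S - S / eta_alpha C) _ hA.
  by rewrite subr_gt0 ltr_pdivrMr ?(lt_trans ltr01)// ltr_pMr.
have nrej k : (N <= k)%N -> ~ rejected r C s k.
  move=> Nk /(run_rejected s_run)[_ ak]; have := aS k.+1; apply/negP.
  rewrite -ltNge ak mulrC -ltr_pdivrMr ?(lt_trans ltr01)//.
  by apply: lt_le_trans (ahomo _ _ Nk); move: SN; rewrite -/S subKr.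
split.
- apply: sub_finite_set (finite_II N) => k /= rk; rewrite ltnNge.
  by apply/negP => /nrej.
- by exists M.
- exists N; elim=> [|k IH]; first by rewrite leqn0 => /eqP ->.
  rewrite leq_eqVlt => /orP[/eqP <- //|/[!ltnS] Nk].
  rewrite -(IH Nk); have [sk|/nrej] := serious_or_rejected r C s k.
    exact: (run_serious s_run sk).2.
  by move=> /(_ Nk).
Qed.
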